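(* Let $n,\ell\ge1$ and let $k=(k_1,\dots,k_\ell)$ be a partition of $n$. A bounded symbol $a\in L^\infty(\mathbb{P}^n(\mathbb{C}))$ is $k$-quasi-radial if and only if it belongs to $\mu_\ell^*(L^\infty(P_\ell))$, where $P_\ell=\mu_\ell(\mathbb{P}^n(\mathbb{C}))$ is the polytope associated to the moment map $\mu_\ell$; that is, if and only if there exists $\widehat a\in L^\infty(P_\ell)$ such that $a=\widehat a\circ\mu_\ell$.
   Context: A partition of $n$ is $k=(k_1,\dots,k_\ell)$ with integers $k_j\ge1$, $k_1+\dots+k_\ell=n$. It decomposes $w\in\mathbb{C}^{n+1}$ as $w=(w_0,w_{(1)},\dots,w_{(\ell)})$ with $w_0\in\mathbb{C}$ and $w_{(j)}\in\mathbb{C}^{k_j}$ consecutive blocks of coordinates. $|\cdot|$ is the Euclidean norm. A $k$-quasi-radial symbol is a function $a\in L^\infty(\mathbb{P}^n(\mathbb{C}))$ such that $a([w])=\widetilde a(|w_0|,|w_{(1)}|,\dots,|w_{(\ell)}|)$ for some function $\widetilde a:[0,\infty)^{\ell+1}\to\mathbb{C}$ that is homogeneous of degree $0$ (under multiplication by positive scalars). The torus $\mathbb{T}^\ell\simeq\{(t_0,\dots,t_\ell)\in\mathbb{T}^{\ell+1}:t_0\cdots t_\ell=1\}$ acts on $\mathbb{P}^n(\mathbb{C})$ by $t\cdot[w]=[t_0w_0,t_1w_{(1)},\dots,t_\ell w_{(\ell)}]$; this action is Hamiltonian for the Fubini–Study symplectic form, with moment map $$\mu_\ell:\mathbb{P}^n(\mathbb{C})\to\Big\{x\in\mathbb{R}^{\ell+1}:x_0+\dots+x_\ell=\tfrac12\Big\},\qquad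 \mu_\ell([w])=\frac{1}{2|w|^2}\big(|w_0|^2,|w_{(1)}|^2,\dots,|w_{(\ell)}|^2\big).$$ This formula is taken as the definition of $\mu_\ell$. $L^\infty(P_\ell)$ is with respect to $\ell$-dimensional Lebesgue measure on the affine hyperplane; functions are identified when equal almost everywhere. *)

(* Defs.v *)
From HB Require Import structures.
From mathcomp Require Import all_boot all_order all_algebra.
From mathcomp Require Import generic_quotient complex.
From mathcomp Require Import all_classical all_reals all_analysis.
From mathcomp Require Import measurable_realfun.

Set Implicit Arguments.
Unset Strict Implicit.
Unset Printing Implicit Defensive.

Import Order.TTheory GRing.Theory Num.Theory.
Import numFieldNormedType.Exports.
Import ComplexField.Normc.

Local Open Scope classical_set_scope.
Local Open Scope ring_scope.
Local Open Scope complex_scope.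
Local Open Scope quotient_scope.

(* The Borel sigma-algebra of C, transported from R * R. *)
Section complex_measurable.
Context {R : realType}.

Definition Cpair (z : R[i]) : R * R := (complex.Re z, complex.Im z).

HB.instance Definition _ := isPointed.Build R[i] 0.

Let cmeas : set (set R[i]) := preimage_set_system setT Cpair measurable.

Let cmeas_sigma : sigma_algebra setT cmeas.
Proof. exact/sigma_algebra_preimage/sigma_algebra_measurable. Qed.

Let cmeas0 : cmeas set0.
Proof. by case: cmeas_sigma. Qed.

Let cmeasC A : cmeas A -> cmeas (~` A).
Proof. by case: cmeas_sigma => _ + _ => /[apply]; rewrite setTD. Qed.

Let cmeasU (F : (set R[i])^nat) : (forall i, cmeas (F i)) ->
  cmeas (\bigcup_i F i).
Proof. by case: cmeas_sigma => _ _; apply. Qed.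

HB.instance Definition _ :=
  @isMeasurable.Build default_measure_display R[i] cmeas cmeas0 cmeasC cmeasU.

Lemma measurable_Cpair : measurable_fun setT Cpair.
Proof. by move=> _ A mA; exists A. Qed.

Lemma measurable_toC d (T : measurableType d) (D : set T) (f : T -> R[i]) :
  measurable_fun D (Cpair \o f) -> measurable_fun D f.
Proof. by move=> mf mD _ [A mA <-]; rewrite setTI; exact: mf. Qed.

Lemma measurable_Re : measurable_fun setT (@complex.Re R).
Proof. exact: (measurableT_comp measurable_fst measurable_Cpair). Qed.

Lemma measurable_Im : measurable_fun setT (@complex.Im R).
Proof. exact: (measurableT_comp measurable_snd measurable_Cpair). Qed.

Lemma measurable_Complex :
  measurable_fun setT (fun p : R * R => p.1 +i* p.2).
Proof.
apply: measurable_toC; rewrite (_ : _ \o _ = id) //.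
by apply/funext => -[].
Qed.

Lemma measurable_normc : measurable_fun setT (@normc R).
Proof.
rewrite (_ : @normc R =
  Num.sqrt \o (fun z => (@complex.Re R z) ^+ 2 + (@complex.Im R z) ^+ 2)); last first.
  by apply/funext => -[].
apply: (measurableT_comp (continuous_measurable_fun (@sqrt_continuous R))).
by apply: measurable_funD; apply: measurable_funX;
  [exact: measurable_Re|exact: measurable_Im].
Qed.

End complex_measurable.

Section pushforward_lcan.
Context d1 d2 (T1 : measurableType d1) (T2 : measurableType d2) (R : realType).
Variables (m : set T1 -> \bar R) (f : T1 -> T2) (g : T2 -> T1).
Hypotheses (mg : measurable_fun setT g) (fK : cancel f g).

Lemma sigma_finite_pushforward :
  sigma_finite setT m -> sigma_finite setT (pushforward m f).
Proof.
move=> [F TF Foo].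
exists (fun i => g @^-1` F i).
  by rewrite -preimage_bigcup -TF preimage_setT.
move=> i; have [mF Fi] := Foo i; split.
  by rewrite -[X in measurable X]setTI; exact: mg.
rewrite /pushforward -comp_preimage (_ : g \o f = id) //.
by apply/funext => x; exact: fK.
Qed.

End pushforward_lcan.

Lemma sigma_finite_product d1 d2 (T1 : measurableType d1)
    (T2 : measurableType d2) (R : realType)
    (m1 : {sigma_finite_measure set T1 -> \bar R})
    (m2 : {sigma_finite_measure set T2 -> \bar R}) :
  sigma_finite setT (m1 \x m2)%E.
Proof.
have /sigma_finiteP[F [TF ndF Foo]] := sigma_finiteT m1.
have /sigma_finiteP[G [TG ndG Goo]] := sigma_finiteT m2.
exists (fun n => F n `*` G n).
  rewrite -setXTT TF TG predeqE => -[x y]; split.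
    move=> [/= [n _ Fnx] [k _ Gky]]; exists (maxn n k) => //; split.
      by move: x Fnx; exact/subsetPset/ndF/leq_maxl.
    by move: y Gky; exact/subsetPset/ndG/leq_maxr.
  by move=> [n _ []/= ? ?]; split; exists n.
move=> k; have [? ?] := Foo k; have [? ?] := Goo k.
split; first exact: measurableX.
by rewrite product_measure1E// lte_mul_pinfty// ge0_fin_numE.
Qed.

Section tuple_measure.
Context d (T : measurableType d) (R : realType).
Variable m : {sigma_finite_measure set T -> \bar R}.

Definition tuple_cons n (x : T * n.-tuple T) : n.+1.-tuple T :=
  [tuple of x.1 :: x.2].

Lemma measurable_tuple_cons n : measurable_fun setT (@tuple_cons n).
Proof. exact: measurable_cons. Qed.

Definition tuple_uncons n (x : n.+1.-tuple T) : T * n.-tuple T :=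
  (thead x, [tuple of behead x]).

Lemma measurable_tuple_uncons n : measurable_fun setT (@tuple_uncons n).
Proof.
apply: measurable_fun_pair; last exact: measurable_behead.
exact: measurable_tnth.
Qed.

Lemma tuple_consK n : cancel (@tuple_cons n) (@tuple_uncons n).
Proof. by move=> [x t]; congr pair; apply/val_inj. Qed.

Section tuple_step.
Variables (n : nat) (nu : {sigma_finite_measure set (n.-tuple T) -> \bar R}).

Definition tuple_step : set (n.+1.-tuple T) -> \bar R :=
  pushforward (m \x nu)%E (@tuple_cons n).

HB.instance Definition _ := Measure.copy tuple_step
  (@measure_function_pushforward__canonical__measure_function_Measure
     _ _ _ _ _ (m \x nu)%E _ (@measurable_tuple_cons n)).

Let tuple_step_sigma_finite : sigma_finite setT tuple_step.
Proof.
apply: (sigma_finite_pushforward (@measurable_tuple_uncons n)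
  (@tuple_consK n)).
exact: sigma_finite_product.
Qed.

HB.instance Definition _ :=
  Measure_isSigmaFinite.Build _ _ _ tuple_step tuple_step_sigma_finite.

End tuple_step.

Fixpoint tuple_measure n : {sigma_finite_measure set (n.-tuple T) -> \bar R} :=
  match n with
  | 0 => \d_ [tuple]
  | n'.+1 => tuple_step (tuple_measure n')
  end.

End tuple_measure.

Section lebesgue.
Variable R : realType.

(* lebesgue_measure lives on measurableTypeR R; this is the same set function,
   on R with its own (convertible) measurableType structure. *)
Definition lebesgue_R : set R -> \bar R := @lebesgue_measure R.

HB.instance Definition _ := @isMeasure.Build default_measure_display R R
  lebesgue_R (measure0 (@lebesgue_measure R)) (measure_ge0 (@lebesgue_measure R))
  (@measure_semi_sigma_additive _ _ _ (@lebesgue_measure R)).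

HB.instance Definition _ :=
  @Measure_isSigmaFinite.Build default_measure_display R R
    lebesgue_R (sigma_finiteT (@lebesgue_measure R)).

Definition lebesgue_C : set R[i] -> \bar R :=
  pushforward (lebesgue_R \x lebesgue_R)%E (fun p : R * R => p.1 +i* p.2).

HB.instance Definition _ := Measure.copy lebesgue_C
  (@measure_function_pushforward__canonical__measure_function_Measure
     _ _ _ _ _ (lebesgue_R \x lebesgue_R)%E _ (@measurable_Complex R)).

Let lebesgue_C_sigma_finite : sigma_finite setT lebesgue_C.
Proof.
apply: (sigma_finite_pushforward (@measurable_Cpair R)); first by case.
exact: sigma_finite_product.
Qed.

HB.instance Definition _ :=
  Measure_isSigmaFinite.Build _ _ _ lebesgue_C lebesgue_C_sigma_finite.

Definition lebesgue_Rn n : {sigma_finite_measure set (n.-tuple R) -> \bar R} :=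
  tuple_measure lebesgue_R n.

Definition lebesgue_Cn n :
    {sigma_finite_measure set (n.-tuple R[i]) -> \bar R} :=
  tuple_measure lebesgue_C n.

End lebesgue.

Section projective_space.
Variables (R : realType) (n : nat).

Definition nonzero_vector : Type :=
  {w : n.+1.-tuple R[i] | [exists i, tnth w i != 0]}.

HB.instance Definition _ := Choice.on nonzero_vector.

Definition same_line (v w : nonzero_vector) : bool :=
  `[< exists2 c : R[i], c != 0 &
      forall i, tnth (val w) i = c * tnth (val v) i >].

Lemma same_line_refl : reflexive same_line.
Proof. by move=> v; apply/asboolP; exists 1 => [|i]; rewrite ?oner_neq0 ?mul1r. Qed.

Lemma same_line_sym : symmetric same_line.
Proof.
move=> v w; apply/idP/idP => /asboolP[c c0 vw]; apply/asboolP;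
  by exists c^-1 => [|i]; rewrite ?invr_eq0 // vw mulKf.
Qed.

Lemma same_line_trans : transitive same_line.
Proof.
move=> v u w /asboolP[c c0 uv] /asboolP[e e0 vw]; apply/asboolP.
by exists (e * c) => [|i]; rewrite ?mulf_neq0 // vw uv mulrA.
Qed.

Canonical same_line_equiv :=
  EquivRel same_line same_line_refl same_line_sym same_line_trans.

Definition projective : Type := {eq_quot same_line}.

HB.instance Definition _ := Choice.on projective.
HB.instance Definition _ := EqQuotient.on projective.

(* w |-> [w] *)
Definition line (w : nonzero_vector) : projective := \pi_projective w.

Lemma lineP (v w : nonzero_vector) : reflect
  (exists2 c : R[i], c != 0 & forall i, tnth (val w) i = c * tnth (val v) i)
  (line v == line w).
Proof. by rewrite /line eqmodE; exact: asboolP. Qed.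

Lemma lineK (p : projective) : line (repr p) = p.
Proof. exact: reprK. Qed.

Lemma affine_neq0 (z : n.-tuple R[i]) :
  [exists i, tnth [tuple of (1 : R[i]) :: z] i != 0].
Proof. by apply/existsP; exists ord0; rewrite tnth0 oner_neq0. Qed.

(* z |-> [1 : z_1 : ... : z_n] *)
Definition affine_chart (z : n.-tuple R[i]) : projective :=
  line (exist _ [tuple of (1 : R[i]) :: z] (affine_neq0 z)).

HB.instance Definition _ :=
  isPointed.Build projective (affine_chart (nseq_tuple n 0)).

(* The quotient sigma-algebra, which is the Borel sigma-algebra of P^n(C): A is
   measurable iff the punctured cone over A is a Borel set of C^{n+1}. *)
Definition punctured_cone (A : set projective) : set (n.+1.-tuple R[i]) :=
  val @` (line @^-1` A).

Lemma punctured_coneT :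
  punctured_cone setT = \bigcup_(i : 'I_n.+1) [set w | tnth w i != 0].
Proof.
apply/seteqP; split=> [_ [[w /= w0] _ <-]|w [i _ /= wi]].
  by have /existsP[i wi] := w0; exists i.
have w0 : [exists i, tnth w i != 0] by apply/existsP; exists i.
by exists (exist _ w w0).
Qed.

Lemma measurable_punctured_coneT : measurable (punctured_cone setT).
Proof.
rewrite punctured_coneT; apply: fin_bigcup_measurable => // i _.
rewrite (_ : [set _ | _] =
  (fun w : n.+1.-tuple R[i] => normc (tnth w i)) @^-1` (~` [set 0])).
  rewrite -[X in measurable X]setTI.
  apply: (measurableT_comp (@measurable_normc R) (measurable_tnth i)) => //.
  exact: measurableC.
apply/seteqP; split => w /= wi; first by move/eq0_normc/eqP; exact/negP.
by apply: contra_notN wi => /eqP ->; rewrite normc0.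
Qed.

Let pmeas (A : set projective) := measurable (punctured_cone A).

Let pmeas0 : pmeas set0.
Proof. by rewrite /pmeas /punctured_cone preimage_set0 image_set0. Qed.

Let pmeasC A : pmeas A -> pmeas (~` A).
Proof.
move=> mA; rewrite /pmeas (_ : _ (~` A) = punctured_cone setT `\` punctured_cone A).
  by apply: measurableD => //; exact: measurable_punctured_coneT.
apply/seteqP; split=> [_ [w nAw <-]|_ [[w _ <-] nAw]].
  by split; [exists w|move=> [v Av /val_inj vw]; apply: nAw; rewrite -vw].
by exists w => // Aw; apply: nAw; exists w.
Qed.

Let pmeasU (F : (set projective)^nat) : (forall i, pmeas (F i)) ->
  pmeas (\bigcup_i F i).
Proof.
move=> mF; rewrite /pmeas /punctured_cone preimage_bigcup image_bigcup.
exact: bigcupT_measurable.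
Qed.

HB.instance Definition _ :=
  @isMeasurable.Build default_measure_display projective pmeas pmeas0 pmeasC pmeasU.

Lemma measurable_affine_chart : measurable_fun setT affine_chart.
Proof.
move=> _ A mA; rewrite setTI.
rewrite (_ : _ @^-1` A =
  (fun z : n.-tuple R[i] => [tuple of (1 : R[i]) :: z]) @^-1` punctured_cone A).
  rewrite -[X in measurable X]setTI.
  apply: (measurable_cons (measurable_cst (1 : R[i])) (@measurable_id _ _ setT)) => //.
apply/seteqP; split => z /=.
  by move=> Az; exists (exist _ [tuple of (1 : R[i]) :: z] (affine_neq0 z)).
move=> [w Aw wz]; rewrite /affine_chart (_ : exist _ _ _ = w) //.
exact/val_inj.
Qed.

End projective_space.

Section euclidean_norm.
Variable R : realType.

(* |w|^2, restricted to the coordinates selected by P *)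
Definition sqnorm n (P : pred 'I_n) (w : n.-tuple R[i]) : R :=
  \sum_(i < n | P i) normc (tnth w i) ^+ 2.

Lemma sqnorm_ge0 n (P : pred 'I_n) (w : n.-tuple R[i]) : 0 <= sqnorm P w.
Proof. by apply: sumr_ge0 => i _; exact: sqr_ge0. Qed.

Lemma measurable_sqnorm n (P : pred 'I_n) : measurable_fun setT (@sqnorm n P).
Proof.
rewrite /sqnorm; under eq_fun do rewrite big_mkcond /=.
apply: measurable_sum => i; case: (P i); last exact: measurable_cst.
apply: measurable_funX.
exact: (measurableT_comp (@measurable_normc R) (measurable_tnth i)).
Qed.

End euclidean_norm.

Section fubini_study.
Variables (R : realType) (n : nat).

Definition fubini_study_density (z : n.-tuple R[i]) : R :=
  ((1 + sqnorm predT z) ^+ n.+1)^-1.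

Lemma fubini_study_density_gt0 z : 0 < fubini_study_density z.
Proof. by rewrite invr_gt0 exprn_gt0 // ltr_wpDr // sqnorm_ge0. Qed.

Lemma measurable_fubini_study_density :
  measurable_fun setT (EFin \o fubini_study_density).
Proof.
apply/measurable_EFinP.
have oF : open [set x : R | x != 0] by exact: (@open_neq R 0).
apply: (@measurable_comp _ _ _ _ _ _ [set x : R | x != 0] (fun x : R => x^-1)
  setT (fun z : n.-tuple R[i] => (1 + sqnorm predT z) ^+ n.+1)).
- exact: open_measurable.
- move=> _ [z _ <-]; apply: lt0r_neq0.
  by rewrite exprn_gt0 // ltr_wpDr // sqnorm_ge0.
- apply: open_continuous_measurable_fun => // x /set_mem; exact: inv_continuous.
- apply: measurable_funX; apply: measurable_funD => //.
  exact: measurable_sqnorm.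
Qed.

(* The Riemannian volume omega^n / n! of the Fubini-Study form
   omega = (i/2) d dbar log(1 + |z|^2), computed in the affine chart, whose
   complement is a null hyperplane; the total mass is pi^n / n!. *)
Definition fubini_study (A : set (projective R n)) : \bar R :=
  \int[lebesgue_Cn R n]_(z in @affine_chart R n @^-1` A)
    (fubini_study_density z)%:E.

Let fubini_study0 : fubini_study set0 = 0%E.
Proof. by rewrite /fubini_study preimage_set0 integral_set0. Qed.

Let fubini_study_ge0 A : (0 <= fubini_study A)%E.
Proof.
by apply: integral_ge0 => z _; rewrite lee_fin ltW // fubini_study_density_gt0.
Qed.

Let fubini_study_sigma_additive : semi_sigma_additive fubini_study.
Proof.
move=> F mF tF mUF; rewrite /fubini_study preimage_bigcup.
have mFi i : measurable (@affine_chart R n @^-1` F i).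
  by rewrite -[X in measurable X]setTI; exact: measurable_affine_chart.
apply: semi_sigma_additive_nng_induced => //.
- exact: measurable_fubini_study_density.
- by move=> z; rewrite lee_fin ltW // fubini_study_density_gt0.
- apply/trivIsetP => i j _ _ ij; rewrite -preimage_setI.
  by move/trivIsetP : tF => /(_ i j Logic.I Logic.I ij) ->; rewrite preimage_set0.
- exact: bigcupT_measurable.
Qed.

HB.instance Definition _ := isMeasure.Build _ _ _ fubini_study
  fubini_study0 fubini_study_ge0 fubini_study_sigma_additive.

End fubini_study.

Section essentially_bounded.
Context d (T : measurableType d) (R : realType).

(* L^oo(D, mu) for a measurable set D of T, as a condition on representatives;
   the values of f outside D are irrelevant. *)
Definition Linfty (mu : {measure set T -> \bar R}) (D : set T) (f : T -> R[i]) :=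
  measurable_fun D f /\
  exists M : R, {ae mu, forall x, D x -> normc (f x) <= M}.

End essentially_bounded.

Definition is_partition (n l : nat) (k : l.-tuple nat) : Prop :=
  (forall j, 1 <= tnth k j)%N /\ (\sum_(j < l) tnth k j = n)%N.

Section quasi_radial.
Variables (R : realType) (n l : nat) (k : l.-tuple nat).

(* coordinate i belongs to the block w_(j), the blocks having sizes
   1, k_1, ..., k_l *)
Definition in_block (j : 'I_l.+1) (i : 'I_n.+1) : bool :=
  (sumn (take j (1%N :: k)) <= i < sumn (take j.+1 (1%N :: k)))%N.

(* (|w_0|, |w_(1)|, ..., |w_(l)|) *)
Definition block_norms (w : n.+1.-tuple R[i]) : l.+1.-tuple R :=
  [tuple Num.sqrt (sqnorm (in_block j) w) | j < l.+1].

(* homogeneity of degree 0 on [0, +oo[^{l+1} *)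
Definition homogeneous0 (f : l.+1.-tuple R -> R[i]) : Prop :=
  forall (t : R) (r : l.+1.-tuple R), 0 < t -> (forall j, 0 <= tnth r j) ->
    f [tuple t * tnth r j | j < l.+1] = f r.

(* Elements of L^oo are identified when equal almost everywhere, so the identity
   defining quasi-radiality is required at almost every p, and then for every
   choice of homogeneous coordinates w of p. *)
Definition is_quasi_radial (a : projective R n -> R[i]) : Prop :=
  Linfty (@fubini_study R n) setT a /\
  exists2 atilde : l.+1.-tuple R -> R[i], homogeneous0 atilde &
    {ae @fubini_study R n, forall p, forall w : nonzero_vector R n,
       line w = p -> a p = atilde (block_norms (val w))}.

Definition moment_coords (w : n.+1.-tuple R[i]) : l.+1.-tuple R :=
  [tuple tnth (block_norms w) j ^+ 2 / (2 * sqnorm predT w) | j < l.+1].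

Definition moment_map (p : projective R n) : l.+1.-tuple R :=
  moment_coords (val (repr p)).

Lemma moment_mapE (w : nonzero_vector R n) :
  moment_map (line w) = moment_coords (val w).
Proof.
have /eqP/lineP[c c0 wE] := lineK (line w).
have sE P : sqnorm P (val w) = normc c ^+ 2 * sqnorm P (val (repr (line w))).
  by rewrite mulr_sumr; apply: eq_bigr => i _; rewrite wE normcM exprMn.
apply: eq_from_tnth => j; rewrite !tnth_mktuple !sqr_sqrtr ?sqnorm_ge0 //.
have c2 : normc c ^+ 2 != 0.
  by rewrite expf_neq0 //; apply: contra c0 => /eqP/eq0_normc ->.
by rewrite !sE (mulrCA 2) -mulf_div divff // mul1r.
Qed.

Definition moment_polytope : set (l.+1.-tuple R) := range moment_map.

End quasi_radial.

(* l-dimensional Lebesgue measure on the hyperplane x_0 + ... + x_l = 1/2 of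
   R^{l+1}, parametrized by (x_1, ..., x_l), with Jacobian sqrt(l+1). *)
Section hyperplane.
Variables (R : realType) (l : nat).

Definition hyperplane_param (x : l.-tuple R) : l.+1.-tuple R :=
  [tuple of 2^-1 - \sum_(j < l) tnth x j :: x].

Lemma measurable_hyperplane_param : measurable_fun setT hyperplane_param.
Proof.
apply: measurable_cons => //; apply: measurable_funB => //.
by apply: measurable_sum => j; exact: measurable_tnth.
Qed.

Definition hyperplane_pushforward : set (l.+1.-tuple R) -> \bar R :=
  pushforward (lebesgue_Rn R l) hyperplane_param.

HB.instance Definition _ := Measure.copy hyperplane_pushforward
  (@measure_function_pushforward__canonical__measure_function_Measure
     _ _ _ _ _ (lebesgue_Rn R l) _ measurable_hyperplane_param).

Definition lebesgue_hyperplane : {measure set (l.+1.-tuple R) -> \bar R} :=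
  mscale (NngNum (sqrtr_ge0 (l.+1%:R : R))) hyperplane_pushforward.

End hyperplane.

(* Main.v *)
(* The moment map and the block norms determine each other up to a positive
   scalar, so a symbol that factors through the moment map is quasi-radial.
   Conversely, atilde need not be measurable, and the point is to replace it by
   a Borel function. In the chart [1 : z], the symbol b(z) is almost everywhere a
   function g(N z) of the block radii N z = (|z_(1)|, ..., |z_(l)|). The
   block dilations z |-> (|s_j| z_(j))_j preserve null sets and multiply N z by
   |s|; hence by Fubini there is a single point z0 with nonzero radii such that
   b (s . z0) = g (|s| N z0) for almost every s, and h(r) := b ((r / N z0) . z0)
   is Borel and equal to g almost everywhere. As N pulls back null sets to null
   sets (again by Fubini over dilations), b = h o N almost everywhere, and N z is
   recovered from the moment map as sqrt (x_j / x_0). *)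

Require Import Defs.
From mathcomp Require Import all_boot all_order all_algebra.
From mathcomp Require Import complex.
From mathcomp Require Import all_classical all_reals all_analysis.
From mathcomp Require Import measurable_realfun.
From mathcomp Require Import ring.

Set Implicit Arguments.
Unset Strict Implicit.
Unset Printing Implicit Defensive.

Import Order.TTheory GRing.Theory Num.Theory.
Import numFieldNormedType.Exports.
Import ComplexField.Normc.

Local Open Scope classical_set_scope.
Local Open Scope ring_scope.

(** * Null sets of product measures through their sections *)

Section product_null.
Local Open Scope ereal_scope.
Context d1 d2 (T1 : measurableType d1) (T2 : measurableType d2) (R : realType).

(** The product measure is the integral of the nonnegative function [m2 (xsection A x)], and such an
    integral vanishes exactly when its integrand does almost everywhere. *)
Lemma product_measure_eq0 (m1 : {measure set T1 -> \bar R})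
    (m2 : {sigma_finite_measure set T2 -> \bar R}) (A : set (T1 * T2)) :
  measurable A ->
  (m1 \x m2) A = 0 <-> \forall x \ae m1, m2 (xsection A x) = 0.
Proof.
move=> mA.
have mf := measurable_fun_xsection m2 mA.
have -> : (m1 \x m2) A = \int[m1]_x `|m2 (xsection A x)|.
  by apply: eq_integral => x _; rewrite gee0_abs.
rewrite (@ae_eq_integral_abs _ _ _ m1 _ measurableT (fun x => m2 (xsection A x)) mf).
split; apply: filterS => x /=; first exact.
by move=> ->.
Qed.

(** Tonelli for null sets: by uniqueness of the product measure, integrating the sections in the
    other order also gives 0. *)
Lemma ae_ysection_eq0 (m1 : {sigma_finite_measure set T1 -> \bar R})
    (m2 : {sigma_finite_measure set T2 -> \bar R}) (A : set (T1 * T2)) :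
  measurable A -> (\forall x \ae m1, m2 (xsection A x) = 0) ->
  \forall y \ae m2, m1 (ysection A y) = 0.
Proof.
move=> mA /(product_measure_eq0 _ _ mA) A0.
have mf := measurable_fun_ysection m1 mA.
have : (m1 \x^ m2) A = 0.
  rewrite -A0; apply/esym; apply: (@product_measure_unique _ _ _ _ _ _ _
    (m1 \x^ m2)%E) => // B C mB mC.
  exact: product_measure2E.
have -> : (m1 \x^ m2) A = \int[m2]_x `|m1 (ysection A x)|.
  by apply: eq_integral => x _; rewrite gee0_abs.
move/(@ae_eq_integral_abs _ _ _ m2 _ measurableT (fun x => m1 (ysection A x)) mf).
by apply: filterS => x /=; exact.
Qed.

End product_null.

(** Nonsingularity in the sense of ergodic theory: the pushforward of [mu] by [f] is absolutely
    continuous with respect to [mu]. It passes to products without any tracking of Jacobians. *)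
Definition nonsingular d (T : measurableType d) (R : realType)
    (mu : set T -> \bar R) (f : T -> T) :=
  measurable_fun setT f /\
  forall A, measurable A -> mu A = 0%E -> mu (f @^-1` A) = 0%E.

(** The section at [x] of the preimage of [A] is the [g]-preimage of the section of [A] at [f x], so
    [g] handles each section and [f] the exceptional set of sections. *)
Lemma nonsingular_prod d1 d2 (T1 : measurableType d1) (T2 : measurableType d2)
    (R : realType) (m1 : {measure set T1 -> \bar R})
    (m2 : {sigma_finite_measure set T2 -> \bar R}) (f : T1 -> T1) (g : T2 -> T2) :
  nonsingular m1 f -> nonsingular m2 g ->
  nonsingular (m1 \x m2)%E (fun x => (f x.1, g x.2)).
Proof.
move=> [mf f0] [mg g0].
have mfg : measurable_fun setT (fun x : T1 * T2 => (f x.1, g x.2)).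
  by apply: measurable_fun_pair; [exact: measurableT_comp mf measurable_fst|
    exact: measurableT_comp mg measurable_snd].
split=> // A mA /(product_measure_eq0 _ _ mA) [N [mN N0 AN]].
apply/product_measure_eq0; first by rewrite -[X in measurable X]setTI; exact: mfg.
exists (f @^-1` N); split.
- by rewrite -[X in measurable X]setTI; exact: mf.
- exact: f0.
move=> x /= hx; apply: AN => /= h; apply: hx.
have -> : xsection ((fun x : T1 * T2 => (f x.1, g x.2)) @^-1` A) x =
    g @^-1` xsection A (f x).
  by apply/seteqP; split=> y; rewrite /xsection /= !inE.
by apply: g0 => //; exact: measurable_xsection.
Qed.

(** * Null sets of the product measure on tuples *)

Section tuple_null.
Context d (T : measurableType d) (R : realType).
Variable m : {sigma_finite_measure set T -> \bar R}.

Lemma tuple_measureS n (A : set (n.+1.-tuple T)) :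
  tuple_measure m n.+1 A = (m \x tuple_measure m n)%E (@tuple_cons _ T n @^-1` A).
Proof. by []. Qed.

Lemma tuple_measure_setT_gt0 n : (0 < m setT)%E ->
  (0 < tuple_measure m n setT)%E.
Proof.
move=> m0; elim: n => [|n IH]; first by rewrite /= diracT.
rewrite tuple_measureS preimage_setT -setXTT product_measure1E //.
exact: mule_gt0.
Qed.

Lemma nonsingular_tuple n (f : 'I_n -> T -> T) : (forall i, nonsingular m (f i)) ->
  nonsingular (tuple_measure m n) (fun t => [tuple f i (tnth t i) | i < n]).
Proof.
elim: n f => [|n IH] f fP.
  have -> : (fun t : 0.-tuple T => [tuple f i (tnth t i) | i < 0]) = id.
    by apply/funext => t; rewrite tuple0 [RHS]tuple0.
  by split.
have mF : measurable_fun setT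
    (fun t : n.+1.-tuple T => [tuple f i (tnth t i) | i < n.+1]).
  apply/measurable_fun_tnthP => i.
  rewrite (_ : _ \o _ = f i \o (fun t => tnth t i)); last first.
    by apply/funext => t /=; rewrite tnth_mktuple.
  by apply: measurableT_comp; [case: (fP i)|exact: measurable_tnth].
split=> // A mA; rewrite !tuple_measureS => A0.
have [_] := nonsingular_prod (fP ord0) (IH (fun i => f (lift ord0 i)) (fun i => fP _)).
move=> /(_ _ _ A0); rewrite -[X in measurable X]setTI.
move=> /(_ (measurable_tuple_cons measurableT mA)).
congr (_ = _); congr (product_measure1 _ _ _).
have consE x (t : n.-tuple T) :
    tuple_cons (f ord0 x, [tuple f (lift ord0 i) (tnth t i) | i < n]) =
    [tuple f i (tnth (tuple_cons (x, t)) i) | i < n.+1].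
  apply: eq_from_tnth => i; rewrite tnth_mktuple /tuple_cons.
  have [j ->|->] := unliftP ord0 i; first by rewrite !tnthS tnth_mktuple.
  by rewrite !tnth0.
by apply/seteqP; split=> -[x t] /=; rewrite consE.
Qed.

Lemma tuple_measure_tnth_eq0 n (i : 'I_n) (A : set T) : measurable A ->
  m A = 0%E -> tuple_measure m n [set t | A (tnth t i)] = 0%E.
Proof.
move=> mA A0; elim: n i => [[]//|n IH] i; rewrite tuple_measureS.
have [j ->|->] := unliftP ord0 i.
  rewrite (_ : _ @^-1` _ = setT `*` [set t | A (tnth t j)]).
    rewrite product_measure1E // ?IH ?mule0 //.
    by rewrite -[X in measurable X]setTI; exact: measurable_tnth.
  by apply/seteqP; split=> -[x t] /=; rewrite /tuple_cons tnthS //; case.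
rewrite (_ : _ @^-1` _ = A `*` setT).
  rewrite product_measure1E //.
  exact: etrans (congr1 (fun u => u * _)%E A0) (mul0e _).
by apply/seteqP; split=> -[x t] /=; rewrite /tuple_cons tnth0 //; case.
Qed.

End tuple_null.

(** * Positive dilations and Lebesgue null sets *)

Section scaling.
Variable R : realType.

(** The measure [A] |-> [c] times the length of the preimage of [A] agrees with Lebesgue measure on
    half-open intervals, hence everywhere. *)
Lemma nonsingular_lebesgue_R (c : R) : 0 < c ->
  nonsingular (@lebesgue_R R) (fun x => c * x).
Proof.
move=> c0; split; first exact: mulrl_measurable.
move=> A mA A0.
pose f : measurableTypeR R -> measurableTypeR R := fun x => c * x.
have mf : measurable_fun setT f by exact: mulrl_measurable.
pose nu : {measure set (measurableTypeR R) -> \bar R} :=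
  mscale (NngNum (ltW c0)) (pushforward (@lebesgue_measure R) f).
have : lebesgue_measure A = nu mf A.
  apply: lebesgue_measure_unique => // _ [[a b]] _ <-.
  change (lebesgue_measure (`]a, b] : set R) =
    (c%:E * lebesgue_measure (f @^-1` `]a, b]))%E).
  have -> : f @^-1` `]a, b] = `]c^-1 * a, c^-1 * b]%classic.
    by apply/seteqP; split=> x /=; rewrite !in_itv /= ltr_pdivrMl ?ler_pdivlMl.
  rewrite !lebesgue_measure_itv /= !lte_fin ltr_pM2l ?invr_gt0 //.
  case: ifP => _; last by rewrite mule0.
  by rewrite -!EFinB -EFinM -mulrBr mulVKf // gt_eqF.
rewrite (A0 : lebesgue_measure A = 0%E) => /esym/eqP.
rewrite /nu /mscale mule_eq0 eqe gt_eqF //= => /eqP; exact.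
Qed.

Lemma nonsingular_lebesgue_C (c : R) : 0 < c ->
  nonsingular (@lebesgue_C R) (fun z => c%:C%C * z).
Proof.
move=> c0; have [mf f0] := nonsingular_lebesgue_R c0.
have [mff ff0] :=
  nonsingular_prod (nonsingular_lebesgue_R c0) (nonsingular_lebesgue_R c0).
have fE : (fun z : R[i] => c%:C%C * z) = (fun p : R * R => (p.1 +i* p.2)%C) \o
    (fun p : R * R => (c * p.1, c * p.2)) \o (@Cpair R).
  by apply/funext => -[x y] /=; rewrite /real_complex_def; congr (_ +i* _)%C; ring.
split.
  rewrite fE; apply: measurableT_comp; last exact: measurable_Cpair.
  by apply: measurableT_comp => //; exact: measurable_Complex.
move=> A mA A0; rewrite /lebesgue_C /pushforward.
have := ff0 _ (_ : measurable ((fun p : R * R => (p.1 +i* p.2)%C) @^-1` A)) A0.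
rewrite -[X in measurable X]setTI => /(_ (measurable_Complex measurableT mA)) <-.
by rewrite fE.
Qed.

Lemma nonsingular_lebesgue_Rn n (c : 'I_n -> R) : (forall i, 0 < c i) ->
  nonsingular (lebesgue_Rn R n) (fun x => [tuple c i * tnth x i | i < n]).
Proof.
move=> c0; apply: (@nonsingular_tuple _ _ _ (@lebesgue_R R) n (fun i x => c i * x)).
by move=> i; exact: nonsingular_lebesgue_R.
Qed.

Lemma nonsingular_lebesgue_Cn n (c : 'I_n -> R) : (forall i, 0 < c i) ->
  nonsingular (lebesgue_Cn R n) (fun z => [tuple (c i)%:C%C * tnth z i | i < n]).
Proof.
move=> c0; apply: (@nonsingular_tuple _ _ _ (@lebesgue_C R) n
  (fun i x => (c i)%:C%C * x)).
by move=> i; exact: nonsingular_lebesgue_C.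
Qed.

Lemma lebesgue_R_set1 (x : R) : lebesgue_R [set x] = 0%E.
Proof. exact: lebesgue_measure_set1. Qed.

Lemma lebesgue_RT_gt0 : (0 < @lebesgue_R R setT)%E.
Proof. by rewrite /lebesgue_R -set_itvNyy lebesgue_measure_itv /= addye ?lt0y. Qed.

Lemma measurable_set1_complex : measurable [set (0 : R[i])].
Proof.
rewrite (_ : [set 0] = @normc R @^-1` [set 0]).
  by rewrite -[X in measurable X]setTI; exact: measurable_normc.
apply/seteqP; split=> z /=; first by move=> ->; rewrite normc0.
exact: eq0_normc.
Qed.

Lemma lebesgue_C_set1_0 : lebesgue_C [set (0 : R[i])] = 0%E.
Proof.
rewrite /lebesgue_C /pushforward (_ : _ @^-1` _ = [set (0 : R)] `*` [set (0 : R)]).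
  rewrite product_measure1E //.
  exact: etrans (congr1 (fun u => u * _)%E (lebesgue_R_set1 0)) (mul0e _).
by apply/seteqP; split=> -[x y] /=; [case=> -> ->|case=> -> ->].
Qed.

Lemma lebesgue_CT_gt0 : (0 < @lebesgue_C R setT)%E.
Proof.
rewrite /lebesgue_C /pushforward preimage_setT -setXTT product_measure1E //.
by apply: mule_gt0; exact: lebesgue_RT_gt0.
Qed.

End scaling.

(** * Borel factorization through the block radii *)

Section block_radii.
Variables (R : realType) (n l : nat) (beta : 'I_n -> 'I_l).
Hypothesis beta_surj : forall j, exists i, beta i = j.

(** The absolute values let [s] range over all of R^l with its Lebesgue measure, instead of the
    positive orthant; only the null coordinate hyperplanes give degenerate dilations. *)
Definition block_scale (s : l.-tuple R) (z : n.-tuple R[i]) : n.-tuple R[i] :=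
  [tuple `|tnth s (beta i)|%:C%C * tnth z i | i < n].

Definition block_radii (z : n.-tuple R[i]) : l.-tuple R :=
  [tuple Num.sqrt (sqnorm (fun i => beta i == j) z) | j < l].

Lemma tnth_block_radii_scale s z j :
  tnth (block_radii (block_scale s z)) j = `|tnth s j| * tnth (block_radii z) j.
Proof.
rewrite !tnth_mktuple /sqnorm.
rewrite (eq_bigr (fun i => `|tnth s j| ^+ 2 * normc (tnth z i) ^+ 2)); last first.
  move=> i /eqP <-; rewrite tnth_mktuple normcM exprMn; congr (_ ^+ 2 * _).
  by rewrite /= expr0n addr0 sqrtr_sqr normr_id.
by rewrite -mulr_sumr sqrtrM ?sqr_ge0 // sqrtr_sqr normr_id.
Qed.

Lemma measurable_block_scale :
  measurable_fun setT (fun x : l.-tuple R * n.-tuple R[i] => block_scale x.1 x.2).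
Proof.
apply/measurable_fun_tnthP => i.
rewrite (_ : _ \o _ = (fun x : l.-tuple R * n.-tuple R[i] =>
  (`|tnth x.1 (beta i)|%:C%C * tnth x.2 i))); last first.
  by apply/funext => x /=; rewrite tnth_mktuple.
have ms : measurable_fun setT
    (fun x : l.-tuple R * n.-tuple R[i] => `|tnth x.1 (beta i)|).
  apply: measurableT_comp; first exact: normr_measurable.
  exact: measurableT_comp (measurable_tnth _) measurable_fst.
have mz : measurable_fun setT (fun x : l.-tuple R * n.-tuple R[i] => tnth x.2 i).
  exact: measurableT_comp (measurable_tnth _) measurable_snd.
apply: measurable_toC.
rewrite (_ : _ \o _ = (fun x : l.-tuple R * n.-tuple R[i] =>
  (`|tnth x.1 (beta i)| * complex.Re (tnth x.2 i),
   `|tnth x.1 (beta i)| * complex.Im (tnth x.2 i)))); last first.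
  apply/funext => x /=; case: (tnth x.2 i) => u v.
  by rewrite /Cpair /=; congr (_, _); ring.
apply: measurable_fun_pair; apply: measurable_funM => //.
  exact: measurableT_comp (@measurable_Re R) mz.
exact: measurableT_comp (@measurable_Im R) mz.
Qed.

Lemma measurable_block_radii : measurable_fun setT block_radii.
Proof.
apply/measurable_fun_tnthP => j.
rewrite (_ : _ \o _ = Num.sqrt \o sqnorm (fun i => beta i == j)); last first.
  by apply/funext => z /=; rewrite tnth_mktuple.
apply: measurableT_comp; last exact: measurable_sqnorm.
exact: continuous_measurable_fun (@sqrt_continuous R).
Qed.

Lemma ae_block_radii_gt0 :
  \forall z \ae lebesgue_Cn R n, forall j, 0 < tnth (block_radii z) j.
Proof.
apply: filter_forall => j; have [i ij] := beta_surj j.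
exists [set z : n.-tuple R[i] | [set 0] (tnth z i)]; split.
- rewrite -[X in measurable X]setTI; apply: measurable_tnth => //.
  exact: measurable_set1_complex.
- apply: tuple_measure_tnth_eq0; first exact: measurable_set1_complex.
  exact: lebesgue_C_set1_0.
move=> z /= zj; apply: contra_notP zj => zi.
rewrite tnth_mktuple sqrtr_gt0 /sqnorm (bigD1 i) /=; last exact/eqP.
rewrite ltr_pwDl //; last by apply: sumr_ge0 => ? _; exact: sqr_ge0.
rewrite lt0r sqr_ge0 andbT expf_neq0 //.
by apply/eqP => /eq0_normc.
Qed.

Lemma ae_tnth_neq0 : \forall s \ae lebesgue_Rn R l, forall j, tnth s j != 0.
Proof.
apply: filter_forall => j.
exists [set s : l.-tuple R | [set 0] (tnth s j)]; split.
- rewrite -[X in measurable X]setTI; exact: measurable_tnth.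
- by apply: tuple_measure_tnth_eq0 => //; exact: lebesgue_R_set1.
by move=> s /= /negP; rewrite negbK => /eqP.
Qed.

Lemma nonsingular_block_scale s : (forall j, tnth s j != 0) ->
  nonsingular (lebesgue_Cn R n) (block_scale s).
Proof. by move=> s0; apply: nonsingular_lebesgue_Cn => i; rewrite normr_gt0. Qed.

Lemma factor_through_block_radii d (Y : measurableType d)
    (b : n.-tuple R[i] -> Y) (g : l.-tuple R -> Y) : measurable_fun setT b ->
  (\forall z \ae lebesgue_Cn R n, b z = g (block_radii z)) ->
  exists2 h : l.-tuple R -> Y, measurable_fun setT h &
    \forall z \ae lebesgue_Cn R n, b z = h (block_radii z).
Proof.
move=> mb [Z [mZ Z0 bZ]].
have bg z : ~ Z z -> b z = g (block_radii z).
  by move=> nZz; apply: contra_notP nZz => ?; exact: bZ.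
(* Positive total mass makes the almost-everywhere filters proper, so that a property holding almost
   everywhere has a witness. *)
have CnT_gt0 := tuple_measure_setT_gt0 n (lebesgue_CT_gt0 R).
have RnT_gt0 := tuple_measure_setT_gt0 l (lebesgue_RT_gt0 R).
(* By Fubini, some z0 with nonzero radii has block_scale s z0 outside Z for
   almost every s; h is read off b along the orbit of this z0. *)
pose A := (fun x : l.-tuple R * n.-tuple R[i] => block_scale x.1 x.2) @^-1` Z.
have mA : measurable A.
  by rewrite -[X in measurable X]setTI; exact: measurable_block_scale.
have : \forall s \ae lebesgue_Rn R l, lebesgue_Cn R n (xsection A s) = 0%E.
  apply: filterS ae_tnth_neq0 => s s0.
  rewrite (_ : xsection A s = block_scale s @^-1` Z); last first.
    by apply/seteqP; split=> z; rewrite /xsection /= inE.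
  by have [_] := nonsingular_block_scale s0; apply.
move/(ae_ysection_eq0 mA) => A0.
have [z0 [Bz0 N0]] := @filter_ex _ _ (ae_properfilter_algebraOfSetsType CnT_gt0) _
  (filterI A0 ae_block_radii_gt0).
(* [q z] is the dilation parameter carrying the radii of [z0] to those of [z]. *)
pose q z : l.-tuple R :=
  [tuple tnth (block_radii z) j / tnth (block_radii z0) j | j < l].
have mq : measurable_fun setT q.
  apply/measurable_fun_tnthP => j.
  rewrite (_ : _ \o _ = (fun r => r * (tnth (block_radii z0) j)^-1) \o
      (fun r : l.-tuple R => tnth r j) \o block_radii); last first.
    by apply/funext => z /=; rewrite tnth_mktuple.
  apply: measurableT_comp measurable_block_radii.
  by apply: measurableT_comp; [exact: mulrr_measurable|exact: measurable_tnth].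
pose B := ysection A z0.
have mB : measurable B by exact: measurable_ysection.
have BE s : B s = Z (block_scale s z0).
  by apply/propext; rewrite /B /ysection /= inE.
(* Averaging over a dilation s: the set of z with q (block_scale s z) in B is
   null for almost every s, and dilations preserve null sets. *)
have Q0 : lebesgue_Cn R n (q @^-1` B) = 0%E.
  pose A' : set (n.-tuple R[i] * l.-tuple R) :=
    (q \o (fun x => block_scale x.2 x.1)) @^-1` B.
  have mA' : measurable A'.
    rewrite -[X in measurable X]setTI; apply: measurableT_comp => //.
    apply: (measurableT_comp measurable_block_scale
      (measurable_fun_pair measurable_snd measurable_fst)).
  have : \forall z \ae lebesgue_Cn R n, lebesgue_Rn R l (xsection A' z) = 0%E.
    apply: filterS ae_block_radii_gt0 => z zgt0.
    have c0 j : 0 < tnth (block_radii z) j / tnth (block_radii z0) j.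
      by rewrite divr_gt0.
    (* The two parameters agree up to signs, which [block_scale] ignores. Thus the section of [A']
       at [z] is the preimage of the null set [B] under a positive dilation of R^l. *)
    have qE s : block_scale (q (block_scale s z)) z0 = block_scale
        [tuple tnth (block_radii z) j / tnth (block_radii z0) j * tnth s j | j < l] z0.
      apply: eq_from_tnth => i; rewrite [LHS]tnth_mktuple [RHS]tnth_mktuple.
      congr (_%:C%C * _); rewrite [X in _ = `|X|]tnth_mktuple.
      rewrite [tnth (q _) _]tnth_mktuple tnth_block_radii_scale.
      by rewrite !normrM normr_id; ring.
    have [_ /(_ _ mB Bz0)] := nonsingular_lebesgue_Rn c0.
    congr (lebesgue_Rn R l _ = _); apply/seteqP; split => s;
      by rewrite /xsection /A' /= inE /= !BE qE.
  move/(ae_ysection_eq0 mA') => A'0.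
  have [s [As s0]] := @filter_ex _ _ (ae_properfilter_algebraOfSetsType RnT_gt0) _
    (filterI A'0 ae_tnth_neq0).
  (* Dilating by [s'] undoes the dilation by [s], so pulling the null section of [A'] at [s] back
     along it gives exactly the preimage of [B] under [q]. *)
  pose s' : l.-tuple R := [tuple (tnth s j)^-1 | j < l].
  have s'0 j : tnth s' j != 0 by rewrite tnth_mktuple invr_eq0.
  have [_ /(_ _ (measurable_ysection _ mA') As) <-] := nonsingular_block_scale s'0.
  congr (lebesgue_Cn R n _); apply/seteqP; split => z;
    rewrite /ysection /A' /= inE /=;
    rewrite (_ : block_scale s (block_scale s' z) = z) //;
    apply: eq_from_tnth => i; rewrite !tnth_mktuple mulrA -rmorphM -normrM;
    by rewrite divff // normr1 rmorph1 mul1r.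
exists (fun r => b (block_scale [tuple tnth r j / tnth (block_radii z0) j | j < l] z0)).
  apply: measurableT_comp => //.
  apply: (measurableT_comp measurable_block_scale
    (measurable_fun_pair _ (measurable_cst z0))).
  apply/measurable_fun_tnthP => j.
  rewrite (_ : _ \o _ = (fun r => r * (tnth (block_radii z0) j)^-1) \o
      (fun r : l.-tuple R => tnth r j)); last first.
    by apply/funext => z /=; rewrite tnth_mktuple.
  by apply: measurableT_comp; [exact: mulrr_measurable|exact: measurable_tnth].
have nZ : \forall z \ae lebesgue_Cn R n, ~ Z z.
  by exists Z; split=> // z /= /contrapT.
have nQ : \forall z \ae lebesgue_Cn R n, ~ B (q z).
  exists (q @^-1` B); split=> //; last by move=> z /= /contrapT.
  by rewrite -[X in measurable X]setTI; exact: mq.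
apply: filterS (filterI nZ (filterI nQ ae_block_radii_gt0)) => z /= [nZz [nBz zgt0]].
rewrite BE in nBz.
(* Both [z] and its counterpart [block_scale (q z) z0] on the orbit of [z0] avoid [Z], and they have
   the same radii. *)
rewrite bg // [RHS]bg //; congr g; apply: eq_from_tnth => j.
rewrite tnth_block_radii_scale tnth_mktuple ger0_norm ?divrK //.
  by rewrite unitfE gt_eqF.
by rewrite divr_ge0 // ltW.
Qed.

End block_radii.

(* beta i is the index of the block containing coordinate i + 1, the block of
   w_0 being excluded. *)
Lemma block_index_exists n l (k : l.-tuple nat) : is_partition n k ->
  exists2 beta : 'I_n -> 'I_l, forall j, exists i, beta i = j &
    forall i j, in_block k (lift ord0 j) (lift ord0 i) = (beta i == j).
Proof.
move=> [k1 kn].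
have sumk : sumn k = n by rewrite sumnE big_tuple.
(* Block 0 is the single coordinate 0; removing it shifts both indices by one and leaves the
   consecutive blocks of [reshape]. *)
have blockE (i : 'I_n) (j : 'I_l) :
    in_block k (lift ord0 j) (lift ord0 i) = (reshape_index k i == j :> nat).
  rewrite /in_block !lift0 /= !add1n !ltnS (take_nth 0%N) ?size_tuple // sumn_rcons.
  apply/andP/eqP => [[ji ij]|<-].
    have {1}-> : i = flatten_index k j (i - sumn (take j k)) :> nat.
      by rewrite /flatten_index subnKC.
    by rewrite flatten_indexKl // ltn_subLR.
  have : (i < sumn k)%N by rewrite sumk.
  move/reshape_offsetP => offset_lt; have iE := reshape_indexK k i.
  by split; [rewrite -[leqRHS]iE leq_addr|rewrite -[X in (X < _)%N]iE ltn_add2l].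
have blockP (i : 'I_n) : exists j, forall j',
    in_block k (lift ord0 j') (lift ord0 i) = (j == j').
  have ik : (reshape_index k i < l)%N.
    by rewrite -[X in (_ < X)%N](size_tuple k) reshape_indexP // sumk.
  by exists (Ordinal ik) => j'; rewrite blockE.
have [beta betaP] := fin_all_exists blockP.
exists beta => // j.
(* Since block [j] is nonempty, its first position, the sum of the preceding sizes, is an index
   below [n] that [beta] sends to [j]. *)
have kj : (0 < nth 0 k j)%N by rewrite -tnth_nth.
have jn : (sumn (take j k) < n)%N.
  rewrite -sumk -[X in (_ < sumn X)%N](cat_take_drop j k) sumn_cat.
  by rewrite -[X in (X < _)%N]addn0 ltn_add2l (drop_nth 0%N) ?size_tuple //= addn_gt0 kj.
exists (Ordinal jn); apply/eqP; rewrite -betaP blockE /=.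
by rewrite -[X in reshape_index _ X]addn0 flatten_indexKl.
Qed.

(** * Measurability of inversion and of equality sets *)

Section real_complex_measurability.
Variable R : realType.

(** Writing the inverse as x (x^2)^(-1) gives [powR] a nonnegative base, where exponent -1 is
    inversion; at 0 both sides are 0. *)
Lemma measurable_invr : measurable_fun setT (fun x : R => x^-1).
Proof.
rewrite (_ : (fun _ => _) = fun x : R => x * (x ^+ 2) `^ (-1)).
  apply: measurable_funM => //.
  exact: (measurableT_comp (@measurable_powR R (-1)) (@exprn_measurable R setT 2)).
apply/funext => x; rewrite powR_inv1 ?sqr_ge0 //.
have [->|x0] := eqVneq x 0; first by rewrite invr0 mul0r.
by rewrite expr2 invfM mulrA divff // mul1r.
Qed.

Lemma measurable_eq_complex d (T : measurableType d) (f g : T -> R[i]) :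
  measurable_fun setT f -> measurable_fun setT g -> measurable [set x | f x = g x].
Proof.
move=> mf mg.
have mE (u : R[i] -> R) : measurable_fun setT u ->
    measurable [set x | u (f x) == u (g x)].
  move=> mu; rewrite -[X in measurable X]setTI.
  exact: (measurable_fun_eqr (measurableT_comp mu mf) (measurableT_comp mu mg)
    measurableT (_ : measurable [set true])).
rewrite (_ : [set x | f x = g x] =
  [set x | complex.Re (f x) == complex.Re (g x)] `&`
  [set x | complex.Im (f x) == complex.Im (g x)]).
  by apply: measurableI; apply: mE; [exact: measurable_Re|exact: measurable_Im].
apply/seteqP; split=> x /=; first by move=> ->.
by case: (f x) (g x) => [? ?] [? ?] /= [/eqP -> /eqP ->].
Qed.

End real_complex_measurability.

(** * Null sets and measurability on projective space *)

Section projective_null.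
Variables (R : realType) (n : nat).

(** The Fubini-Study density is strictly positive, so it does not change the null sets of the
    chart. *)
Lemma fubini_study_eq0 (A : set (projective R n)) : measurable A ->
  fubini_study A = 0%E <-> lebesgue_Cn R n (@affine_chart R n @^-1` A) = 0%E.
Proof.
move=> mA; set D := _ @^-1` A.
have mD : measurable D.
  by rewrite -[X in measurable X]setTI; exact: measurable_affine_chart.
have mf : measurable_fun D (EFin \o @fubini_study_density R n).
  exact: measurable_funS (@measurable_fubini_study_density R n).
have -> : fubini_study A =
    (\int[lebesgue_Cn R n]_(z in D) `|(EFin \o @fubini_study_density R n) z|)%E.
  apply: eq_integral => z _; rewrite gee0_abs //=.
  by rewrite lee_fin ltW // fubini_study_density_gt0.
split=> [|D0]; last exact: integral_abs_eq0.
move/(ae_eq_integral_abs _ mD mf) => [N [mN N0 DN]].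
apply: (subset_measure0 mD mN _ N0) => z Dz; apply: DN => /= /(_ Dz) [] /eqP.
by rewrite gt_eqF // fubini_study_density_gt0.
Qed.

Lemma ae_affine_chart (P : projective R n -> Prop) :
  (\forall p \ae @fubini_study R n, P p) ->
  \forall z \ae lebesgue_Cn R n, P (affine_chart z).
Proof.
move=> [N [mN /(fubini_study_eq0 mN) N0 PN]].
exists (@affine_chart R n @^-1` N); split=> //.
  by rewrite -[X in measurable X]setTI; exact: measurable_affine_chart.
by move=> z /= nP; apply: PN.
Qed.

(** Measurability makes the exceptional set its own null cover, so that no cover has to be carried
    from the chart back to projective space. *)
Lemma ae_fubini_study (P : projective R n -> Prop) : measurable [set p | P p] ->
  (\forall z \ae lebesgue_Cn R n, P (affine_chart z)) ->
  \forall p \ae @fubini_study R n, P p.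
Proof.
move=> mP Pz; have mC : measurable (~` [set p | P p]) by exact: measurableC.
exists (~` [set p | P p]); split=> //; apply/fubini_study_eq0 => //.
apply: measure_negligible => //.
by rewrite -[X in measurable X]setTI; exact: measurable_affine_chart.
Qed.

Variables (l : nat) (k : l.-tuple nat).

Lemma measurable_moment_coords :
  measurable_fun setT (@moment_coords R n l k).
Proof.
apply/measurable_fun_tnthP => j.
rewrite (_ : _ \o _ = fun w => sqnorm (in_block k j) w *
    (fun x => x^-1) (2 * sqnorm predT w)); last first.
  by apply/funext => w /=; rewrite !tnth_mktuple sqr_sqrtr // sqnorm_ge0.
apply: measurable_funM; first exact: measurable_sqnorm.
apply: measurableT_comp; first exact: measurable_invr.
by apply: measurable_funM => //; exact: measurable_sqnorm.
Qed.

(** The representative chosen by [repr] need not depend measurably on the line. By homogeneity,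
    however, the punctured cone over a preimage is the preimage under [moment_coords], restricted to
    nonzero vectors. *)
Lemma measurable_moment_map : measurable_fun setT (@moment_map R n l k).
Proof.
move=> _ A mA; rewrite setTI.
have mcA : measurable (@moment_coords R n l k @^-1` A).
  by rewrite -[X in measurable X]setTI; exact: measurable_moment_coords.
have := measurableI _ _ (@measurable_punctured_coneT R n) mcA.
congr measurable; apply/seteqP; split=> [_ [[w _ <-] wA]|_ [w wA <-]].
  by exists w => //=; rewrite moment_mapE.
by split; [exists w|rewrite /= -moment_mapE].
Qed.

End projective_null.

(** * Block norms and the moment map in the affine chart *)

Section blocks.
Variables (R : realType) (n l : nat) (k : l.-tuple nat).

Lemma in_block_ord0 (i : 'I_n.+1) : in_block k ord0 i = (i == ord0).
Proof. by rewrite /in_block /= take0 /= -val_eqE /= ltnS leqn0. Qed.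

Lemma in_block_lift_ord0 (j : 'I_l) : in_block k (lift ord0 j) (@ord0 n) = false.
Proof. by rewrite /in_block lift0. Qed.

Lemma sqnorm_block0 (w : n.+1.-tuple R[i]) :
  sqnorm (in_block k ord0) w = normc (tnth w ord0) ^+ 2.
Proof. by rewrite /sqnorm (eq_bigl _ _ in_block_ord0) big_pred1_eq. Qed.

Variable beta : 'I_n -> 'I_l.
Hypothesis betaE :
  forall i j, in_block k (lift ord0 j) (lift ord0 i) = (beta i == j).

Lemma sqnorm_blockS (w : n.+1.-tuple R[i]) (j : 'I_l) :
  sqnorm (in_block k (lift ord0 j)) w =
  \sum_(i < n | beta i == j) normc (tnth w (lift ord0 i)) ^+ 2.
Proof.
rewrite /sqnorm big_mkcond big_ord_recl in_block_lift_ord0 /= add0r [RHS]big_mkcond.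
by apply: eq_bigr => i _; rewrite betaE.
Qed.

Lemma sum_sqnorm_block (w : n.+1.-tuple R[i]) :
  \sum_(j < l.+1) sqnorm (in_block k j) w = sqnorm predT w.
Proof.
rewrite big_ord_recl sqnorm_block0 /sqnorm [RHS]big_ord_recl; congr (_ + _).
rewrite (partition_big beta predT) //=.
by apply: eq_bigr => j _; rewrite -sqnorm_blockS.
Qed.

Lemma block_norms_affine (z : n.-tuple R[i]) :
  block_norms k [tuple of (1 : R[i]) :: z] = [tuple of 1 :: block_radii beta z].
Proof.
apply: eq_from_tnth => j; rewrite tnth_mktuple.
have [j' ->|->] := unliftP ord0 j.
  rewrite tnthS tnth_mktuple sqnorm_blockS; congr Num.sqrt.
  by apply: eq_bigr => i _; rewrite tnthS.
by rewrite sqnorm_block0 !tnth0 normc1 expr1n sqrtr1.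
Qed.

(** The common denominator 2|w|^2 cancels in the quotient, and the block of w_0 = 1 has norm 1. *)
Lemma block_radii_moment_map (z : n.-tuple R[i]) (j : 'I_l) :
  Num.sqrt (tnth (moment_map k (affine_chart z)) (lift ord0 j) /
    tnth (moment_map k (affine_chart z)) ord0) = tnth (block_radii beta z) j.
Proof.
rewrite /affine_chart moment_mapE [val _]/=.
have S0 : sqnorm predT [tuple of (1 : R[i]) :: z] != 0.
  rewrite /sqnorm big_ord_recl tnth0 normc1 expr1n gt_eqF // ltr_pwDl //.
  by apply: sumr_ge0 => i _; exact: sqr_ge0.
rewrite [tnth (moment_coords _ _) (lift _ _)]tnth_mktuple.
rewrite [tnth (moment_coords _ _) _]tnth_mktuple block_norms_affine tnth0 tnthS.
rewrite expr1n div1r invrK divfK ?mulf_neq0 ?pnatr_eq0 //.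
by rewrite sqrtr_sqr ger0_norm // tnth_mktuple sqrtr_ge0.
Qed.

End blocks.

Theorem theorem5p4 (R : realType) (n l : nat) (n_ge1 : (1 <= n)%N)
    (l_ge1 : (1 <= l)%N) (k : l.-tuple nat) (k_part : is_partition n k)
    (a : projective R n -> R[i])
    (a_Linfty : Linfty (@fubini_study R n) setT a) :
  is_quasi_radial k a <->
  exists2 ahat : l.+1.-tuple R -> R[i],
    Linfty (@lebesgue_hyperplane R l) (@moment_polytope R n l k) ahat &
    {ae @fubini_study R n, forall p, a p = ahat (moment_map k p)}.
Proof.
have [beta beta_surj betaE] := block_index_exists k_part.
split=> [[_ [atilde _ aE]]|[ahat _ aE]]; last first.
  split=> //.
  (* This is the moment map written in the block norms, |w|^2 being the sum of their squares; a
     quotient of quadratic expressions is homogeneous of degree 0. *)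
  exists (fun r => ahat
    [tuple tnth r j ^+ 2 / (2 * \sum_(i < l.+1) tnth r i ^+ 2) | j < l.+1]).
    move=> t r t0 _; congr ahat; apply: eq_from_tnth => j; rewrite !tnth_mktuple.
    under eq_bigr do rewrite tnth_mktuple exprMn.
    rewrite -mulr_sumr exprMn (mulrCA 2) -mulf_div divff ?mul1r //.
    by rewrite expf_neq0 // gt_eqF.
  apply: filterS aE => p + w wp; rewrite -wp => ->; rewrite moment_mapE; congr ahat.
  apply: eq_from_tnth => j; rewrite [LHS]tnth_mktuple [RHS]tnth_mktuple.
  congr (_ / (2 * _)).
  rewrite -(sum_sqnorm_block betaE); apply: eq_bigr => i _.
  by rewrite tnth_mktuple sqr_sqrtr // sqnorm_ge0.
have [ma [M aM]] := a_Linfty.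
pose b z := a (affine_chart z).
have mb : measurable_fun setT b := measurableT_comp ma (@measurable_affine_chart R n).
have bE : \forall z \ae lebesgue_Cn R n,
    b z = atilde [tuple of 1 :: block_radii beta z].
  apply: filterS (ae_affine_chart aE) => z /(_ _ erefl).
  by rewrite (block_norms_affine betaE).
have [h mh bh] := @factor_through_block_radii _ _ _ _ beta_surj _ _ b
  (fun r => atilde [tuple of 1 :: r]) mb bE.
(* Where x_0 = 0 the convention for division by zero gives [rho] the value 0; on the polytope these
   points come from lines outside the chart. *)
pose rho (x : l.+1.-tuple R) : l.-tuple R :=
  [tuple Num.sqrt (tnth x (lift ord0 j) / tnth x ord0) | j < l].
have mrho : measurable_fun setT rho.
  apply/measurable_fun_tnthP => j.
  rewrite (_ : _ \o _ = Num.sqrt \o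
      (fun x : l.+1.-tuple R => tnth x (lift ord0 j) * (tnth x ord0)^-1)); last first.
    by apply/funext => x /=; rewrite tnth_mktuple.
  apply: measurableT_comp; first exact: continuous_measurable_fun (@sqrt_continuous R).
  apply: measurable_funM; first exact: measurable_tnth.
  exact: measurableT_comp (@measurable_invr R) (measurable_tnth ord0).
(* Truncating at the essential bound M makes ahat bounded everywhere, so that
   the pushforward of the Fubini-Study measure by the moment map need not be
   compared with Lebesgue measure on the polytope. *)
pose ahat x := if normc (h (rho x)) <= M then h (rho x) else 0.
have mahat : measurable_fun setT ahat.
  apply: measurable_fun_ifT; last exact: measurable_cst.
    apply: measurable_fun_ler; last exact: measurable_cst.
    exact: measurableT_comp (@measurable_normc R) (measurableT_comp mh mrho).
  exact: measurableT_comp mh mrho.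
exists ahat.
  split; first exact: measurable_funS mahat.
  exists `|M|; apply: aeW => x _; rewrite /ahat; case: ifPn => [hM|_].
    exact: le_trans hM (ler_norm _).
  by rewrite normc0.
apply: ae_fubini_study.
  apply: measurable_eq_complex => //.
  exact: measurableT_comp mahat (@measurable_moment_map R n l k).
apply: filterS (filterI bh (ae_affine_chart aM)) => z /= [bhz /(_ Logic.I) aMz].
have rhoE : rho (moment_map k (affine_chart z)) = block_radii beta z.
  by apply: eq_from_tnth => j; rewrite tnth_mktuple (block_radii_moment_map betaE).
(* Here [h (rho x)] equals the value of the symbol, which is bounded by [M], so the truncation has
   no effect. *)
by rewrite /ahat rhoE -bhz aMz.
Qed.
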